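(* Let $A$ be a monoid. The set $Id(A)$ of all ideals of $A$ and the set $Id(A)_{\bullet}:=Id(A)\setminus\{A\}$ of all proper ideals of $A$, each endowed with the hull-kernel topology, are spectral spaces.
   Context: A monoid means a commutative monoid, written multiplicatively, with identity $1$ and a base point $0$ satisfying $0\cdot a=0$ for all $a$. An ideal of $A$ is a subset $I\subseteq A$ containing $0$ with $IA\subseteq I$. The hull-kernel topology on the power set $2^A$ is the topology with open subbasis the sets $\{R\subseteq A\mid F\nsubseteq R\}$, $F\subseteq A$ finite; sets of ideals carry the induced subspace topology. A topological space is spectral if it is homeomorphic to the prime spectrum of a commutative ring with the Zariski topology; equivalently it is $T_0$, quasi-compact, has a basis of quasi-compact open subspaces closed under finite intersections, and every irreducible closed subspace has a unique generic point. *)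

(* Defs.v *)
From HB Require Import structures.
From mathcomp Require Import all_boot all_order all_algebra.
From mathcomp Require Import all_classical.
From mathcomp Require Import topology.

Set Implicit Arguments.
Unset Strict Implicit.
Unset Printing Implicit Defensive.

Import GRing.Theory.
Local Open Scope classical_set_scope.

(* The base point may coincide with the identity: the monoid {0} is allowed,
   and it has no proper ideal. *)
HB.mixin Record Monoid_isPointedComMonoid A & Monoid A := {
  mzero : A;
  mmulC : forall a b : A, (a * b)%g = (b * a)%g;
  mmul0 : forall a : A, (mzero * a)%g = mzero
}.

#[short(type="pointedComMonoidType")]
HB.structure Definition PointedComMonoid :=
  {A of Monoid_isPointedComMonoid A & Monoid A}.

(* The alias carries the hull-kernel topology, and subsets of it, seen as types
   through [set_type], carry the subspace topology. *)
Definition hull_kernel (A : Type) : Type := set A.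

HB.instance Definition _ (A : Type) := gen_eqMixin (hull_kernel A).
HB.instance Definition _ (A : Type) := gen_choiceMixin (hull_kernel A).
HB.instance Definition _ (A : Type) :=
  isSubBaseTopological.Build (hull_kernel A)
    [set F : set A | finite_set F]
    (fun F => [set S : hull_kernel A | ~ F `<=` S]).

Section Ideals.
Variable A : pointedComMonoidType.

Definition monoid_ideal (I : set A) : Prop :=
  I mzero /\ forall a b : A, I a -> I (a * b)%g.

Definition Id : set (hull_kernel A) := [set I | monoid_ideal I].

Definition Id_proper : set (hull_kernel A) := Id `\ [set: A].

End Ideals.

Arguments Id : clear implicits.
Arguments Id_proper : clear implicits.

Section PrimeSpectrum.
Local Open Scope ring_scope.

(* [comPzRingType] and not [comNzRingType]: the zero ring is allowed, so that
   the empty space is a prime spectrum.  The prime ideals of [ring_quotient]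
   are only available over nonzero rings. *)
Variable R : comPzRingType.

Definition ring_ideal (P : set R) : Prop :=
  [/\ P 0, (forall x y, P x -> P y -> P (x + y)) & forall r x, P x -> P (r * x)].

Definition ring_prime (P : set R) : Prop :=
  [/\ ring_ideal P, ~ P 1 & forall x y, P (x * y) -> P x \/ P y].

Definition Spec : Type := {P : set R | ring_prime P}.

HB.instance Definition _ := gen_eqMixin Spec.
HB.instance Definition _ := gen_choiceMixin Spec.

Definition zariski_closed_set (E : set R) : set Spec :=
  [set P | E `<=` sval P].

Definition zariski_open (U : set Spec) : Prop :=
  exists E : set R, U = ~` zariski_closed_set E.

Let zariski_openT : zariski_open [set: Spec].
Proof.
exists [set: R]; apply/seteqP; split=> // P _ /= sP.
by have [_ + _] := svalP P; apply; apply: sP.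
Qed.

Let zariski_openI : setI_closed zariski_open.
Proof.
move=> _ _ [E ->] [F ->]; exists [set z | exists2 x, E x & exists2 y, F y & z = x * y].
rewrite -setCU; congr (~` _); apply/seteqP; split=> P /=;
  have [[_ _ PM] _ PP] := svalP P.
- move=> [sE|sF] _ [x Ex [y Fy ->]] /=; last by apply: PM; apply: sF.
  by rewrite mulrC; apply: PM; apply: sE.
- move=> sEF; apply: contrapT => /not_orP[/existsNP[x /not_implyP[Ex nPx]]].
  move=> /existsNP[y /not_implyP[Fy nPy]].
  by case: (PP x y) => //; apply: sEF; exists x => //; exists y.
Qed.

Let zariski_open_bigU (I : Type) (f : I -> set Spec) :
  (forall i, zariski_open (f i)) -> zariski_open (\bigcup_i f i).
Proof.
move=> /choice[E fE]; exists (\bigcup_i E i).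
apply/seteqP; split=> P /=.
- by move=> [i _]; rewrite fE /= => nEP sP; apply: nEP => x Ex; apply: sP; exists i.
- move=> /existsNP[x /not_implyP[[i _ Eix] nPx]].
  by exists i => //; rewrite fE /= => sP; by apply: nPx; apply: sP.
Qed.

HB.instance Definition _ := isOpenTopological.Build Spec
  zariski_openT zariski_openI zariski_open_bigU.

End PrimeSpectrum.

Definition homeomorphic (X Y : topologicalType) : Prop :=
  exists (f : X -> Y) (g : Y -> X),
    [/\ cancel f g, cancel g f, continuous f & continuous g].

Definition spectral (X : topologicalType) : Prop :=
  exists R : comPzRingType, homeomorphic X (Spec R).

(* Main.v *)
Require Import Defs.
From HB Require Import structures.
From mathcomp Require Import all_boot all_order all_algebra.
From mathcomp Require Import all_classical.
From mathcomp Require Import topology.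
From mathcomp Require Import ring.

(** Both spaces are instances of one statement: a family [X] of subsets of a set
    [A] is spectral in the hull-kernel topology as soon as it is closed under
    binary intersections and closed in the patch topology, which means that a
    subset all of whose finite traces are traces of members of [X] belongs to
    [X] ([spectral_of_closed_family]).  Ideals and proper ideals of a monoid are
    cut out by conditions bearing on at most two elements at a time, and an
    intersection of two (proper) ideals is a (proper) ideal.

    The ring with spectrum [X] is an explicit form of a construction of
    Hochster.  Let [K] be the field of rational fractions over the rationals in
    variables indexed by [A].  For a subset [p] of [A], the [residual] fractions
    are those that avoid the variables in [p], and the [infinitesimal] ones
    those of positive order in the variables in [p].  The former make a field
    which is the residue field of the local ring formed by all sums of a
    residual and an infinitesimal fraction.  The ring [section_ring X] consists
    of the functions [h] from [X] to [K] such that [h q] is residual at [q],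
    such that [h p] is the specialization of [h q] whenever [q] is contained in
    [p] (the difference is infinitesimal at [p]), and such that [h q] depends
    only on a finite trace of [q].  Four facts make its spectrum [X]:
    - supports are open: if [h] is determined by traces on [s], and the trace
      of [q] is contained in that of [p], then the intersection of [q] and [p]
      is in [X] and has the trace of [q], so [h q] specializes to [h p] and is
      nonzero when [h p] is ([support_open]);
    - the function equal to the variable [a] off the members containing [a],
      and to 0 on them, is in the ring; its support is the subbasic open set
      of the members that avoid [a];
    - if [f] vanishes wherever [g] does, then [g] divides a power of [f]
      ([section_radical]): [f ^ n / g] still specializes correctly when [n]
      exceeds the order of all values of [g] in all sets of variables, and
      there is such an [n] because [g] has finitely many values and the order
      of a polynomial is bounded by its degree;
    - finite unions of supports are supports, since a sum of two squares
      vanishes in [K] only if both terms do; finite intersections are supports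
      by multiplying.
    Hence a prime [P] is the set of all functions vanishing at the member
    { a | indicator a in P } of [X].

    Polynomials in arbitrarily many variables are represented by the functions
    they induce on rational points, which are faithful because the field of
    rationals is infinite.  Integrality follows by restricting to lines, formal
    reality holds pointwise, and the order of [F] in the variables of [p] is
    the order at [t = 0] of [F] composed with the scaling of these variables
    by [t]. *)

Set Implicit Arguments.
Unset Strict Implicit.
Unset Printing Implicit Defensive.

Import Order.TTheory GRing.Theory Num.Theory.
Local Open Scope classical_set_scope.
Local Open Scope ring_scope.

(** * Polynomial functions in arbitrarily many variables *)

Section PolynomialFunctions.
Variable T : Type.

Inductive polyfun : ((T -> rat) -> rat) -> Prop :=
| polyfun_cst c : polyfun (fun=> c)
| polyfun_coord a : polyfun (fun u => u a)
| polyfunD F G : polyfun F -> polyfun G -> polyfun (F + G)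
| polyfunM F G : polyfun F -> polyfun G -> polyfun (F * G).

Definition polyfun_pred : {pred (T -> rat) -> rat} :=
  [pred F | `[< polyfun F >]].

Lemma polyfun_subring_closed : subring_closed polyfun_pred.
Proof.
split=> [|F G /asboolP pF /asboolP pG|F G /asboolP pF /asboolP pG];
  apply/asboolP.
- exact: polyfun_cst.
- have -> : F - G = F + (fun=> -1) * G.
    by apply/funext => u; rewrite !fctE mulN1r.
  by apply: polyfunD => //; apply: polyfunM => //; apply: polyfun_cst.
- exact: polyfunM.
Qed.

Record polyring := Polyring {
  polyring_val :> (T -> rat) -> rat;
  polyringP : polyring_val \in polyfun_pred }.

Lemma mem_polyfun F : polyfun F -> F \in polyfun_pred.
Proof. by move=> pF; apply/asboolP. Qed.

HB.instance Definition _ := [isSub for polyring_val].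
HB.instance Definition _ := [Choice of polyring by <:].
HB.instance Definition _ := GRing.SubChoice_isSubComPzRing.Build _ _ polyring
  polyfun_subring_closed.

Lemma polyring_oner_neq0 : (1 : polyring) != 0.
Proof.
apply/eqP => /(congr1 (fun F : polyring => F (fun=> 0))) /eqP.
by rewrite oner_eq0.
Qed.

HB.instance Definition _ :=
  GRing.PzSemiRing_isNonZero.Build polyring polyring_oner_neq0.

HB.instance Definition _ := GRing.ComPzRing.on polyring.

Lemma polyring_eqP (F G : polyring) : F =1 G -> F = G.
Proof. by move=> FG; apply/val_inj/funext. Qed.

Definition polycst (c : rat) : polyring :=
  Polyring (mem_polyfun (polyfun_cst c)).
Definition coordf (a : T) : polyring :=
  Polyring (mem_polyfun (polyfun_coord a)).

Lemma polyringD (F G : polyring) u : (F + G) u = F u + G u.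
Proof. by []. Qed.
Lemma polyringM (F G : polyring) u : (F * G) u = F u * G u.
Proof. by []. Qed.

Lemma polyring_ind (P : polyring -> Prop) :
  (forall c, P (polycst c)) -> (forall a, P (coordf a)) ->
  (forall F G, P F -> P G -> P (F + G)) ->
  (forall F G, P F -> P G -> P (F * G)) -> forall F, P F.
Proof.
move=> Pc Px PD PM [f pf]; have /asboolP := pf => pf'.
elim: pf' pf => [c|a|F G pF IF pG IG|F G pF IF pG IG] pf.
- by rewrite (_ : Polyring _ = polycst c) //; apply: val_inj.
- by rewrite (_ : Polyring _ = coordf a) //; apply: val_inj.
- have iF := mem_polyfun pF; have iG := mem_polyfun pG.
  rewrite (_ : Polyring _ = Polyring iF + Polyring iG); first exact: PD.
  exact: val_inj.
- have iF := mem_polyfun pF; have iG := mem_polyfun pG.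
  rewrite (_ : Polyring _ = Polyring iF * Polyring iG); first exact: PM.
  exact: val_inj.
Qed.

(** Restriction to the line joining two points reduces integrality to
    univariate polynomials. *)
Lemma polyring_line (F : polyring) (u w : T -> rat) :
  exists P : {poly rat}, forall s, F (fun a => u a + s * w a) = P.[s].
Proof.
elim/polyring_ind: F => [c|a|F G [P FP] [Q GQ]|F G [P FP] [Q GQ]].
- by exists c%:P => s; rewrite hornerC.
- by exists ((u a)%:P + 'X * (w a)%:P) => s; rewrite !hornerE.
- by exists (P + Q) => s; rewrite hornerD -FP -GQ.
- by exists (P * Q) => s; rewrite hornerM -FP -GQ.
Qed.

Lemma polyring_neq0 (F : polyring) : F != 0 -> exists u, F u != 0.
Proof.
move=> /eqP F0; apply: contrapT => /forallNP Fu; apply: F0.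
by apply: polyring_eqP => u; have /negP/negbNE/eqP := Fu u.
Qed.

(** On the line from a point where [F] does not vanish to one where [G] does
    not, both restrict to nonzero univariate polynomials, whose product would
    have all natural numbers as roots. *)
Lemma polyring_mulf_eq0 (F G : polyring) : F * G = 0 -> (F == 0) || (G == 0).
Proof.
move=> FG0; have [//|/polyring_neq0[u Fu]] := eqVneq F 0.
have [//|/polyring_neq0[w Gw]] := eqVneq G 0.
have [P FP] := polyring_line F u (w - u).
have [Q GQ] := polyring_line G u (w - u).
have P0 : P != 0.
  apply: contraNneq Fu => P0; have := FP 0; rewrite P0 horner0.
  rewrite (_ : (fun a => _) = u) => [->//|].
  by apply/funext => a; rewrite mul0r addr0.
have Q0 : Q != 0.
  apply: contraNneq Gw => Q0; have := GQ 1; rewrite Q0 horner0.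
  rewrite (_ : (fun a => _) = w) => [->//|].
  by apply/funext => a; rewrite mul1r addrC; apply: subrK.
suff PQ0 : P * Q = 0 by have := mulf_neq0 P0 Q0; rewrite PQ0 eqxx.
apply: (@roots_geq_poly_eq0 _ _ [seq i%:R | i <- iota 0 (size (P * Q)).+1]).
- apply/allP => s _; rewrite rootE hornerM -FP -GQ.
  by rewrite -polyringM FG0.
- rewrite map_inj_uniq ?iota_uniq // => i j /eqP.
  by rewrite eqr_nat => /eqP.
- by rewrite size_map size_iota ltnW.
Qed.

Let polyring_unit : {pred polyring} :=
  [pred F : polyring | `[< exists G : polyring, G * F = 1 >]].
Let polyring_inv (F : polyring) : polyring :=
  if pselect (exists G : polyring, G * F = 1) is left e then sval (cid e)
  else F.

Let polyring_mulVr : {in polyring_unit, left_inverse 1 polyring_inv *%R}.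
Proof.
move=> F /asboolP uF; rewrite /polyring_inv; case: pselect => // e.
exact: (svalP (cid e)).
Qed.

Let polyring_unitPl (F G : polyring) : G * F = 1 -> polyring_unit F.
Proof. by move=> GF; apply/asboolP; exists G. Qed.

Let polyring_invr_out : {in [predC polyring_unit], polyring_inv =1 id}.
Proof.
by move=> F /asboolPn nuF; rewrite /polyring_inv; case: pselect.
Qed.

HB.instance Definition _ := GRing.ComNzRing_hasMulInverse.Build polyring
  polyring_mulVr polyring_unitPl polyring_invr_out.

HB.instance Definition _ :=
  GRing.ComUnitRing_isIntegral.Build polyring polyring_mulf_eq0.

End PolynomialFunctions.

(** * The order of a polynomial in a set of variables *)

Section Orders.
Variable T : Type.
Local Notation D := (polyring T).
Implicit Types (p : set T) (F G : D) (P Q : {poly D}).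

Definition dilate p (t : rat) (u : T -> rat) : T -> rat :=
  fun a => if `[< p a >] then t * u a else u a.

(** [P] is the image of [F] under the substitution that multiplies the
    variables in [p] by an indeterminate; it is characterized by its values, as
    is [F]. *)
Definition dilated p F P := forall t u, P.[polycst T t] u = F (dilate p t u).

Lemma dilatedD p F G P Q :
  dilated p F P -> dilated p G Q -> dilated p (F + G) (P + Q).
Proof. by move=> FP GQ t u; rewrite hornerD !polyringD FP GQ. Qed.

Lemma dilatedM p F G P Q :
  dilated p F P -> dilated p G Q -> dilated p (F * G) (P * Q).
Proof. by move=> FP GQ t u; rewrite hornerM !polyringM FP GQ. Qed.

Lemma dilated_cst p c : dilated p (polycst T c) (polycst T c)%:P.
Proof. by move=> t u; rewrite hornerC. Qed.

Lemma dilated_coord_in p a : p a -> dilated p (coordf a) ((coordf a)%:P * 'X).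
Proof.
move=> pa t u; rewrite hornerM hornerC hornerX polyringM /= /dilate.
by rewrite (asboolT pa) mulrC.
Qed.

Lemma dilated_coord_notin p a : ~ p a -> dilated p (coordf a) (coordf a)%:P.
Proof. by move=> pa t u; rewrite hornerC /= /dilate (asboolF pa). Qed.

Lemma polycst1 : polycst T 1 = 1. Proof. exact: polyring_eqP. Qed.

Lemma polycst_inj : injective (polycst T).
Proof. by move=> c d /(congr1 (fun F : D => F (fun=> 0))). Qed.

Lemma dilated_horner1 p F P : dilated p F P -> P.[1] = F.
Proof.
move=> FP; apply: polyring_eqP => u; rewrite -polycst1 FP.
congr (polyring_val F _); apply/funext => a; rewrite /dilate mul1r.
by case: asboolP.
Qed.

(** The difference has infinitely many constants as roots. *)
Lemma dilated_uniq p F P Q : dilated p F P -> dilated p F Q -> P = Q.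
Proof.
move=> FP FQ; apply/eqP; rewrite -subr_eq0; apply/eqP.
apply: (@roots_geq_poly_eq0 _ _
  [seq polycst T i%:R | i <- iota 0 (size (P - Q)).+1]).
- apply/allP => _ /mapP[i _ ->]; rewrite rootE hornerD hornerN subr_eq0.
  by apply/eqP/polyring_eqP => u; rewrite FP FQ.
- rewrite map_inj_uniq ?iota_uniq // => i j /polycst_inj /eqP.
  by rewrite eqr_nat => /eqP.
- by rewrite size_map size_iota ltnW.
Qed.

(** The bound is a degree of [F], which works for all sets of variables at
    once. *)
Lemma dilated_bounded F :
  exists N : nat, forall p,
    exists2 P : {poly D}, (size P <= N)%N & dilated p F P.
Proof.
elim/polyring_ind: F => [c|a|F G [M FM] [N GN]|F G [M FM] [N GN]].
- by exists 1%N => p; exists (polycst T c)%:P; [rewrite size_polyC_leq1|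
    exact: dilated_cst].
- exists 2%N => p; have [pa|pa] := pselect (p a).
    exists ((coordf a)%:P * 'X); last exact: dilated_coord_in.
    apply: leq_trans (size_polyMleq _ _) _; rewrite size_polyX addn2 /=.
    by rewrite ltnS size_polyC_leq1.
  exists (coordf a)%:P; last exact: dilated_coord_notin.
  by apply: leq_trans (size_polyC_leq1 _) _.
- exists (maxn M N) => p; have [P sP FP] := FM p; have [Q sQ GQ] := GN p.
  exists (P + Q); last exact: dilatedD.
  by apply: leq_trans (size_polyD _ _) _; rewrite geq_max !leq_max sP sQ orbT.
- exists (M + N)%N => p; have [P sP FP] := FM p; have [Q sQ GQ] := GN p.
  exists (P * Q); last exact: dilatedM.
  by apply: leq_trans (size_polyMleq _ _) _; apply: leq_trans (leq_pred _) _;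
    apply: leq_add.
Qed.

(** The order of [F] in the variables of [p] is the order at 0 of its
    dilation.  An exact order is witnessed by a cofactor that does not vanish at
    0, so that additivity of orders is integrality of the coefficients. *)
Definition order_ge p k F := exists Q, dilated p F (Q * 'X^k).
Definition order_eq p k F := exists2 Q, Q.[0] != 0 & dilated p F (Q * 'X^k).

(** [F] does not involve the variables in [p]. *)
Definition constant_along p F := dilated p F F%:P.

Lemma order_eqW p k F : order_eq p k F -> order_ge p k F.
Proof. by case=> Q _ FQ; exists Q. Qed.

Lemma order_geW p k l F : (l <= k)%N -> order_ge p k F -> order_ge p l F.
Proof.
by move=> lk [Q FQ]; exists (Q * 'X^(k - l)); rewrite -mulrA -exprD subnK.
Qed.

Lemma constant_along_order_ge p F : constant_along p F -> order_ge p 0 F.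
Proof. by exists F%:P; rewrite expr0 mulr1. Qed.

Lemma constant_along_order_eq p F :
  constant_along p F -> F != 0 -> order_eq p 0 F.
Proof. by move=> iF F0; exists F%:P; rewrite ?hornerC // expr0 mulr1. Qed.

Lemma constant_along1 p : constant_along p 1.
Proof. by rewrite -polycst1; apply: dilated_cst. Qed.

Lemma order_geD p k F G :
  order_ge p k F -> order_ge p k G -> order_ge p k (F + G).
Proof.
by move=> [P FP] [Q GQ]; exists (P + Q); rewrite mulrDl; apply: dilatedD.
Qed.

Lemma order_geM p k l F G :
  order_ge p k F -> order_ge p l G -> order_ge p (k + l) (F * G).
Proof.
by move=> [P FP] [Q GQ]; exists (P * Q); rewrite exprD mulrACA; apply: dilatedM.
Qed.

Lemma order_geX p k F n : order_ge p k F -> order_ge p (k * n) (F ^+ n).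
Proof.
move=> kF; elim: n => [|n IH]; last by rewrite exprS mulnS; apply: order_geM.
by rewrite expr0 muln0; apply/constant_along_order_ge/constant_along1.
Qed.

Lemma order_eqM p k l F G :
  order_eq p k F -> order_eq p l G -> order_eq p (k + l) (F * G).
Proof.
move=> [P P0 FP] [Q Q0 GQ]; exists (P * Q); first by rewrite hornerM mulf_neq0.
by rewrite exprD mulrACA; apply: dilatedM.
Qed.

Lemma order_eqX p k F n : order_eq p k F -> order_eq p (k * n) (F ^+ n).
Proof.
move=> kF; elim: n => [|n IH]; last by rewrite exprS mulnS; apply: order_eqM.
rewrite expr0 muln0.
exact: constant_along_order_eq (constant_along1 p) (oner_neq0 _).
Qed.

Lemma order_eqD p k F G :
  order_eq p k F -> order_ge p k.+1 G -> order_eq p k (F + G).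
Proof.
move=> [P P0 FP] [Q GQ]; exists (P + Q * 'X).
  by rewrite hornerD hornerM hornerX mulr0 addr0.
by rewrite mulrDl -mulrA -exprS; apply: dilatedD.
Qed.

Lemma order_eq_neq0 p k F : order_eq p k F -> F != 0.
Proof.
move=> [Q Q0 FQ]; apply: contraNneq Q0 => F0.
have FQ0 : dilated p F 0 by move=> t u; rewrite F0 horner0.
have /eqP := dilated_uniq FQ FQ0.
rewrite mulf_eq0 expf_eq0 polyX_eq0 andbF orbF.
by move=> /eqP ->; rewrite horner0.
Qed.

Lemma order_eq_nge p k F : order_eq p k F -> ~ order_ge p k.+1 F.
Proof.
move=> [Q Q0 FQ] [P FP]; move: Q0; apply/negP; rewrite negbK.
have /eqP := dilated_uniq FQ FP; rewrite exprS mulrA => /eqP/mulIf ->.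
  by rewrite hornerM hornerX mulr0.
by rewrite expf_eq0 polyX_eq0 andbF.
Qed.

(** This uniformity in [p] is what makes a single exponent suffice at all
    points in [specializing_quotient]. *)
Lemma order_bounded F :
  F != 0 -> exists N : nat, forall p, exists2 k, (k < N)%N & order_eq p k F.
Proof.
move=> F0; have [N FN] := dilated_bounded F; exists N => p.
have [P sP FP] := FN p; have P0 : P != 0.
  by apply: contraNneq F0 => P0; rewrite -(dilated_horner1 FP) P0 horner0.
have [k [Q /implyP/(_ P0) Q0 PQ]] := multiplicity_XsubC P 0.
rewrite subr0 in PQ; exists k; last by exists Q; rewrite -?PQ.
apply: leq_trans sP; rewrite PQ size_Mmonic ?monicXn ?size_polyXn //.
  by rewrite addnS /= -[X in (X < _)%N]add0n ltn_add2r size_poly_gt0;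
    apply: contraNneq Q0 => ->; rewrite root0.
by apply: contraNneq Q0 => ->; rewrite root0.
Qed.

Lemma constant_alongD p F G :
  constant_along p F -> constant_along p G -> constant_along p (F + G).
Proof. by rewrite /constant_along rmorphD; exact: dilatedD. Qed.

Lemma constant_alongM p F G :
  constant_along p F -> constant_along p G -> constant_along p (F * G).
Proof. by rewrite /constant_along rmorphM; exact: dilatedM. Qed.

Lemma constant_alongN p F : constant_along p F -> constant_along p (- F).
Proof.
rewrite -mulN1r => iF; apply: constant_alongM => //.
rewrite (_ : -1 = polycst T (-1)); first exact: dilated_cst.
exact: polyring_eqP.
Qed.

End Orders.

(** * Residual and infinitesimal fractions *)

Local Notation "x %:F" := (FracField.tofrac x).

Lemma fracP (R : idomainType) (phi : {fraction R}) :
  exists F G, G != 0 /\ phi = F%:F / G%:F.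
Proof.
elim/quotW: phi => -[[n d] /= d0]; exists n, d; split=> //.
apply: (canRL (mulfK _)); first by rewrite tofrac_eq0.
unlock FracField.tofrac; rewrite -[LHS]FracField.pi_mul.
apply/eqmodP; rewrite /= FracField.equivfE /FracField.mulf.
by rewrite !numden_Ratio ?mulf_neq0 ?oner_eq0 //= !mulr1 mulrC.
Qed.

Lemma invfD_subV (k : fieldType) (x y x' y' : k) :
  x != 0 -> y != 0 -> y' != 0 -> x * y' + x' * y != 0 ->
  (x / y + x' / y')^-1 - (x / y)^-1
    = - (x' * y * y) / ((x * y' + x' * y) * x).
Proof. by move=> x0 y0 y'0 e0; field; apply/and4P. Qed.

Lemma clear_denom_sqrD (k : fieldType) (x y x' y' : k) : y != 0 -> y' != 0 ->
  (y * y') ^+ 2 * ((x / y) ^+ 2 + (x' / y') ^+ 2)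
    = (x * y') ^+ 2 + (x' * y) ^+ 2.
Proof. by move=> y0 y'0; field; apply/andP. Qed.

Lemma mulrB_increment (R : comPzRingType) (x x' y y' : R) :
  x * y - x' * y' = x' * (y - y') + (y' * (x - x') + (x - x') * (y - y')).
Proof. by ring. Qed.

Section Infinitesimals.
Variable T : Type.
Local Notation D := (polyring T).
Local Notation K := {fraction (polyring T)}.
Implicit Types (p : set T) (F G : D) (phi psi c m : K).

Definition residual p phi :=
  exists F G, [/\ G != 0, constant_along p F, constant_along p G
    & phi = F%:F / G%:F].

Definition infinitesimal p phi := exists F G k,
  [/\ order_ge p k.+1 F, order_eq p k G & phi = F%:F / G%:F].

Let tofrac_neq0 F : F != 0 -> F%:F != 0 :> K.
Proof. by rewrite tofrac_eq0. Qed.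

Lemma residual1 p : residual p 1.
Proof.
exists 1, 1; split; rewrite ?oner_neq0 ?divff ?tofrac1 ?oner_neq0 //;
exact: constant_along1.
Qed.

Lemma residualB p phi psi :
  residual p phi -> residual p psi -> residual p (phi - psi).
Proof.
move=> [F [G [G0 iF iG ->]]] [F' [G' [G'0 iF' iG' ->]]].
exists (F * G' + - F' * G), (G * G'); split.
- exact: mulf_neq0.
- apply: constant_alongD; apply: constant_alongM => //.
  exact: constant_alongN.
- exact: constant_alongM.
by rewrite -mulNr addf_div ?tofrac_neq0 // tofracD !tofracM tofracN.
Qed.

Lemma residual0 p : residual p 0.
Proof. by rewrite -(subrr 1); apply: residualB; apply: residual1. Qed.

Lemma residualM p phi psi :
  residual p phi -> residual p psi -> residual p (phi * psi).
Proof.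
move=> [F [G [G0 iF iG ->]]] [F' [G' [G'0 iF' iG' ->]]].
exists (F * F'), (G * G'); split; [exact: mulf_neq0|exact: constant_alongM..|].
by rewrite mulf_div !tofracM.
Qed.

Lemma residualV p phi : residual p phi -> residual p phi^-1.
Proof.
move=> [F [G [G0 iF iG ->]]]; have [->|F0] := eqVneq F 0.
  by rewrite tofrac0 mul0r invr0; apply: residual0.
by exists G, F; split=> //; rewrite invf_div.
Qed.

Lemma residualX p phi n : residual p phi -> residual p (phi ^+ n).
Proof.
move=> kphi; elim: n => [|n IH]; first exact: residual1.
by rewrite exprS; apply: residualM.
Qed.

Lemma infinitesimal0 p : infinitesimal p 0.
Proof.
exists 0, 1, 0%N; split; last by rewrite tofrac0 mul0r.
  by exists 0 => t u; rewrite mul0r horner0.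
exact: constant_along_order_eq (constant_along1 p) (oner_neq0 _).
Qed.

Lemma infinitesimalD p phi psi :
  infinitesimal p phi -> infinitesimal p psi -> infinitesimal p (phi + psi).
Proof.
move=> [F [G [k [oF oG ->]]]] [F' [G' [k' [oF' oG' ->]]]].
exists (F * G' + F' * G), (G * G'), (k + k')%N; split.
- apply: order_geD; first exact: order_geM oF (order_eqW oG').
  by rewrite addnC -addSn; apply: order_geM oF' (order_eqW oG).
- exact: order_eqM.
rewrite addf_div; last 2 first.
- exact: tofrac_neq0 (order_eq_neq0 oG).
- exact: tofrac_neq0 (order_eq_neq0 oG').
by rewrite tofracD !tofracM.
Qed.

Lemma infinitesimalZ p c phi :
  residual p c -> infinitesimal p phi -> infinitesimal p (c * phi).
Proof.
move=> [F [G [G0 iF iG ->]]] [F' [G' [k' [oF' oG' ->]]]].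
exists (F * F'), (G * G'), (0 + k')%N; split.
- by rewrite -addnS; apply: order_geM => //; apply: constant_along_order_ge.
- by apply: order_eqM => //; apply: constant_along_order_eq.
by rewrite mulf_div !tofracM.
Qed.

Lemma infinitesimalN p phi : infinitesimal p phi -> infinitesimal p (- phi).
Proof.
move=> mphi; rewrite -mulN1r; apply: infinitesimalZ => //.
by rewrite -[-1]sub0r; apply: residualB; [exact: residual0|exact: residual1].
Qed.

Lemma infinitesimalB p phi psi :
  infinitesimal p phi -> infinitesimal p psi -> infinitesimal p (phi - psi).
Proof. by move=> mphi mpsi; apply/infinitesimalD/infinitesimalN. Qed.

Lemma infinitesimalM p phi psi :
  infinitesimal p phi -> infinitesimal p psi -> infinitesimal p (phi * psi).
Proof.
move=> [F [G [k [oF oG ->]]]] [F' [G' [k' [oF' oG' ->]]]].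
exists (F * F'), (G * G'), (k + k')%N; split; last 2 first.
- exact: order_eqM.
- by rewrite mulf_div !tofracM.
- by apply: order_geW (order_geM oF oF'); rewrite addSn addnS leqW.
Qed.

(** A nonzero fraction avoiding the variables in [p] has order 0. *)
Lemma residual_infinitesimal p c : residual p c -> infinitesimal p c -> c = 0.
Proof.
move=> [F [G [G0 iF iG ->]]] [F' [G' [k [oF' oG' /eqP]]]].
have G'0 := order_eq_neq0 oG'.
rewrite eqr_div ?tofrac_neq0 // -!tofracM tofrac_eq => /eqP FG.
have [->|F0] := eqVneq F 0; first by rewrite tofrac0 mul0r.
have := order_eqM (constant_along_order_eq iF F0) oG'.
rewrite FG => /order_eq_nge[]; rewrite add0n -[k.+1]addn0.
by apply: order_geM => //; apply: constant_along_order_ge.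
Qed.

Lemma infinitesimal_mulB p phi phi' psi psi' :
  residual p phi' -> residual p psi' ->
  infinitesimal p (phi - phi') -> infinitesimal p (psi - psi') ->
  infinitesimal p (phi * psi - phi' * psi').
Proof.
move=> rphi rpsi mphi mpsi; rewrite mulrB_increment.
by apply: infinitesimalD; [|apply: infinitesimalD];
  [apply: infinitesimalZ|apply: infinitesimalZ|apply: infinitesimalM].
Qed.

(** Inverting is compatible with specialization at units: sums of a
    residual and an infinitesimal fraction form a local ring. *)
Lemma infinitesimal_inv p c m : residual p c -> c != 0 -> infinitesimal p m ->
  infinitesimal p ((c + m)^-1 - c^-1).
Proof.
move=> [F [G [G0 iF iG ->]]] c0 [F' [G' [k [oF' oG' ->]]]].
have F0 : F != 0 by apply: contraNneq c0 => ->; rewrite tofrac0 mul0r.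
have G'0 := order_eq_neq0 oG'.
have oE : order_eq p k (F * G' + F' * G).
  apply: order_eqD; first exact: order_eqM (constant_along_order_eq iF F0) oG'.
  rewrite -[k.+1]addn0.
  by apply: order_geM => //; apply: constant_along_order_ge.
have E0 := order_eq_neq0 oE.
exists (- (F' * G * G)), ((F * G' + F' * G) * F), (k + 0)%N; split.
- rewrite addn0 -mulN1r -[k.+1]add0n.
  apply: order_geM.
    exact/constant_along_order_ge/constant_alongN/constant_along1.
  rewrite -mulrA -[k.+1]addn0; apply: order_geM => //.
  exact/constant_along_order_ge/constant_alongM.
- by apply: order_eqM => //; apply: constant_along_order_eq.
move: (tofrac_neq0 E0); rewrite !(tofracN, tofracM, tofracD) => E0'.
by apply: invfD_subV E0'; apply: tofrac_neq0.
Qed.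

(** Raising to the [n]-th power multiplies a positive order by [n], which
    eventually exceeds the order of [phi], bounded independently of [p]. *)
Lemma infinitesimal_absorb phi : phi != 0 -> exists N : nat,
  forall p n m, (N <= n)%N -> infinitesimal p m ->
  infinitesimal p (m ^+ n / phi).
Proof.
have [F [G [G0 ->]]] := fracP phi => phi0.
have F0 : F != 0 by apply: contraNneq phi0 => ->; rewrite tofrac0 mul0r.
have [N FN] := order_bounded F0; have [N' GN] := order_bounded G0.
(* The denominator [F] of [phi^-1] has order [j < N], which is made up for by
   the gain of at least one in each of the [n] factors. *)
exists N => p n m Nn [F' [G' [k [oF' oG' ->]]]].
have [j jN oF] := FN p; have [j' _ oG] := GN p.
exists (F' ^+ n * G), (G' ^+ n * F), (k * n + j)%N; split.
- apply: order_geW (order_geM (order_geX n oF') (order_eqW oG)).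
  rewrite mulSn -addnS; apply: leq_trans (leq_addr _ _).
  by rewrite addnC leq_add2r; apply: leq_trans jN Nn.
- by apply: order_eqM => //; apply: order_eqX.
have G'0 := order_eq_neq0 oG'.
by rewrite !tofracM !tofracXn expr_div_n invf_div mulf_div.
Qed.

Lemma residual_coordf p a : ~ p a -> residual p (coordf a)%:F.
Proof.
move=> pa; exists (coordf a), 1; split; rewrite ?oner_neq0 ?tofrac1 ?divr1 //.
  exact: dilated_coord_notin.
exact: constant_along1.
Qed.

Lemma infinitesimal_coordf p a : p a -> infinitesimal p (coordf a)%:F.
Proof.
move=> pa; exists (coordf a), 1, 0%N; split; last by rewrite tofrac1 divr1.
  by exists (coordf a)%:P; rewrite expr1; apply: dilated_coord_in.
exact: constant_along_order_eq (constant_along1 p) (oner_neq0 _).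
Qed.

Lemma coordf_neq0 a : (coordf a)%:F != 0 :> K.
Proof.
apply: tofrac_neq0; apply/eqP => /(congr1 (fun F : D => F (fun=> 1))) /eqP.
by rewrite oner_eq0.
Qed.

(** Clearing denominators reduces to rational-valued functions, where it
    holds pointwise. *)
Lemma sum_squares_eq0 phi psi : phi ^+ 2 + psi ^+ 2 = 0 -> phi = 0 /\ psi = 0.
Proof.
have [F [G [G0 ->]]] := fracP phi; have [F' [G' [G'0 ->]]] := fracP psi.
move=> /(congr1 ( *%R ((G * G') ^+ 2)%:F)).
rewrite mulr0 (_ : _ * _ = ((F * G') ^+ 2 + (F' * G) ^+ 2)%:F); last first.
  by rewrite tofracD !tofracXn !tofracM clear_denom_sqrD ?tofrac_neq0.
move=> /eqP; rewrite tofrac_eq0 => /eqP sq0.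
have FG0 : F * G' = 0 /\ F' * G = 0.
  split; apply: polyring_eqP => u; apply/eqP;
    have /eqP := congr1 (fun F : D => F u) sq0;
    rewrite /= (paddr_eq0 (sqr_ge0 _) (sqr_ge0 _)) !sqrf_eq0; by case/andP.
case: FG0 => /eqP; rewrite mulf_eq0 (negPf G'0) orbF => /eqP ->.
move=> /eqP; rewrite mulf_eq0 (negPf G0) orbF => /eqP ->.
by rewrite tofrac0 !mul0r.
Qed.

End Infinitesimals.

(** * The ring of specializing functions on a family of subsets *)

Section Sections.
Variables (A : eqType) (X : set (hull_kernel A)).
Local Notation K := {fraction (polyring A)}.
Implicit Types (p q : X) (s : seq A) (h g : X -> K).

Definition same_trace s (I J : set A) := forall a, a \in s -> (I a <-> J a).

Definition finitely_determined (V : Type) (h : X -> V) := exists s, forall p q,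
  same_trace s (val p) (val q) -> h p = h q.

(** Inclusion of subsets is specialization of points, since the hull-kernel
    open sets are generated by the conditions [~ q a]. *)
Definition specializing h := [/\ forall q, residual (val q) (h q),
  forall q p, val q `<=` val p -> infinitesimal (val p) (h q - h p) &
  finitely_determined h].

Lemma same_traceS s1 s2 I J :
  {subset s1 <= s2} -> same_trace s2 I J -> same_trace s1 I J.
Proof. by move=> s12 IJ a /s12; apply: IJ. Qed.

Lemma finitely_determined2 (U V W : Type) (op : U -> V -> W)
    (h1 : X -> U) (h2 : X -> V) :
  finitely_determined h1 -> finitely_determined h2 ->
  finitely_determined (fun q => op (h1 q) (h2 q)).
Proof.
move=> [s1 hs1] [s2 hs2]; exists (s1 ++ s2) => p q pq.
rewrite (hs1 p q) ?(hs2 p q) //.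
  by apply: same_traceS pq => a; rewrite mem_cat => ->; rewrite orbT.
by apply: same_traceS pq => a; rewrite mem_cat => ->.
Qed.

(** There are only finitely many traces on a finite set. *)
Lemma finitely_determined_bounded (h : X -> nat) :
  finitely_determined h -> exists N, forall q, (h q <= N)%N.
Proof.
move=> [s hs].
pose trace q := [tuple of map (fun a => `[< val q a >]) (in_tuple s)].
pose bound (b : (size s).-tuple bool) :=
  if pselect (exists q, trace q = b) is left e then h (sval (cid e)) else 0%N.
exists (\max_b bound b) => q; apply: leq_trans (leq_bigmax (trace q)).
rewrite /bound; case: pselect => [e|[]]; last by exists q.
rewrite (hs q (sval (cid e))) // => a sa.
have /(congr1 val)/= /eq_in_map/(_ a sa) := svalP (cid e).
by move=> E; split=> /asboolP; [rewrite -E|rewrite E] => /asboolP.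
Qed.

Lemma specializingB h g :
  specializing h -> specializing g -> specializing (h - g).
Proof.
move=> [rh mh sh] [rg mg sg]; split=> [q|q p qp|].
- exact: residualB.
- have -> : (h - g) q - (h - g) p = (h q - h p) - (g q - g p).
    by rewrite !opprD addrACA.
  by apply: infinitesimalB; [apply: mh|apply: mg].
- exact: (finitely_determined2 (fun x y => x - y) sh sg).
Qed.

Lemma specializingM h g :
  specializing h -> specializing g -> specializing (h * g).
Proof.
move=> [rh mh sh] [rg mg sg]; split=> [q|q p qp|].
- exact: residualM.
- by apply: infinitesimal_mulB; [| |apply: mh|apply: mg].
- exact: (finitely_determined2 *%R sh sg).
Qed.

Lemma specializing1 : specializing 1.
Proof.
split=> [q|q p _|]; first exact: residual1; last by exists [::].
by rewrite subrr; apply: infinitesimal0.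
Qed.

Definition specializing_pred : {pred X -> K} :=
  [pred h | `[< specializing h >]].

Lemma specializing_subring_closed : subring_closed specializing_pred.
Proof.
split=> [|h g /asboolP sh /asboolP sg|h g /asboolP sh /asboolP sg];
  apply/asboolP.
- exact: specializing1.
- exact: specializingB.
- exact: specializingM.
Qed.

Record section_ring := SectionRing {
  section_val :> X -> K;
  section_valP : section_val \in specializing_pred }.

HB.instance Definition _ := [isSub for section_val].
HB.instance Definition _ := [Choice of section_ring by <:].
HB.instance Definition _ :=
  GRing.SubChoice_isSubComPzRing.Build _ _ section_ring
  specializing_subring_closed.

Implicit Types f : section_ring.

Lemma sectionP f : specializing f. Proof. exact/asboolP/section_valP. Qed.

Lemma mem_specializing h : specializing h -> h \in specializing_pred.
Proof. by move=> sh; apply/asboolP. Qed.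

Definition to_section h (sh : specializing h) :=
  SectionRing (mem_specializing sh).

Lemma section_eqP f f' : f =1 f' -> f = f'.
Proof. by move=> ff'; apply/val_inj/funext. Qed.

Lemma sectionD f f' q : (f + f') q = f q + f' q. Proof. by []. Qed.
Lemma sectionM f f' q : (f * f') q = f q * f' q. Proof. by []. Qed.

Lemma sectionX f n q : (f ^+ n) q = f q ^+ n.
Proof. by elim: n => [//|n IH]; rewrite !exprS -IH. Qed.

Lemma specializing_indicator a :
  specializing (fun q => if `[< val q a >] then 0 else (coordf a)%:F).
Proof.
split=> [q|q p qp|].
- case: asboolP => qa; [exact: residual0|exact: residual_coordf].
- case: asboolP => qa; case: asboolP => pa; rewrite ?subrr ?subr0;
    try exact: infinitesimal0; last exact: infinitesimal_coordf.
  by case: pa; apply: qp.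
- exists [:: a] => p q pq; rewrite (_ : `[< val p a >] = `[< val q a >]) //.
  by apply: asbool_equiv_eq; apply: pq; rewrite inE.
Qed.

(** The variable [a] where it is allowed to be nonzero.  For [q] contained in
    [p], the only jump occurs when [a] is in [p] but not in [q], and then the
    variable [a] is infinitesimal at [p]. *)
Definition indicator a : section_ring := to_section (specializing_indicator a).

Lemma indicator_eq0 a q : indicator a q = 0 <-> val q a.
Proof.
rewrite /=; case: asboolP => // qa; split=> // /eqP.
by rewrite (negPf (coordf_neq0 a)).
Qed.

(** A nonzero residual value at [p] cannot be the specialization of 0. *)
Lemma specialize_neq0 f p q : val q `<=` val p -> f p != 0 -> f q != 0.
Proof.
have [rf mf _] := sectionP f => qp; apply: contraNneq => fq0.
apply/eqP; apply: (residual_infinitesimal (rf p)).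
by have /infinitesimalN := mf _ _ qp; rewrite fq0 sub0r opprK.
Qed.

(** Where [g] vanishes the quotient is 0, by the convention on division.
    Specialization from [q] to [p] is an issue only if [g p = 0] and [g q] is
    nonzero: then [f q] is infinitesimal at [p], and a power of it absorbs the
    denominator [g q].  The exponent is positive to make the quotient specialize
    to 0 there, and to make it a cofactor of [g] also where [g] vanishes. *)
Lemma specializing_quotient (f g : section_ring) :
  (forall q, g q = 0 -> f q = 0) ->
  exists n, specializing (fun q => f q ^+ n.+1 / g q).
Proof.
move=> gf0; have [rf mf sf] := sectionP f; have [rg mg sg] := sectionP g.
have /choice[N NP] : forall x : K, exists N : nat, x != 0 ->
    forall (I : set A) n m, (N <= n)%N -> infinitesimal I m ->
    infinitesimal I (m ^+ n / x).
  move=> x; have [->|x0] := eqVneq x 0; first by exists 0%N.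
  by have [N NP] := infinitesimal_absorb x0; exists N.
have [n Nn] : exists n, forall q, (N (g q) <= n)%N.
  apply: finitely_determined_bounded.
  exact: (finitely_determined2 (fun x _ => N x) sg sg).
exists n; have [rfn mfn _] := sectionP (f ^+ n.+1).
split=> [q|q p qp|].
- by apply: residualM; [apply: residualX|apply: residualV].
- have [gp0|gp0] := eqVneq (g p) 0.
    rewrite (gf0 _ gp0) expr0n mul0r subr0.
    have [->|gq0] := eqVneq (g q) 0.
      by rewrite invr0 mulr0; exact: infinitesimal0.
    apply: NP => //; first exact: leqW.
    by rewrite -[f q]subr0 -(gf0 _ gp0); apply: mf.
  apply: infinitesimal_mulB.
  + exact: residualX.
  + exact: residualV.
  + by rewrite -!sectionX; apply: mfn.
  + by rewrite -[g q](subrKC (g p)); apply: infinitesimal_inv => //; apply: mg.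
- exact: (finitely_determined2 (fun x y => x ^+ n.+1 / y) sf sg).
Qed.

Lemma section_radical (f g : section_ring) : (forall q, g q = 0 -> f q = 0) ->
  exists n (h : section_ring), f ^+ n.+1 = h * g.
Proof.
move=> gf0; have [n sh] := specializing_quotient gf0.
exists n, (to_section sh); apply: section_eqP => q; rewrite sectionX sectionM.
have [gq0|gq0] := eqVneq (g q) 0; last by rewrite divfK.
by rewrite gq0 mulr0 (gf0 _ gq0) expr0n.
Qed.

End Sections.

(** * Continuity and the hull-kernel topology *)

Section Subbase.
Variable A : Type.

Lemma hull_kernel_open_notin (a : A) : open [set S : hull_kernel A | ~ S a].
Proof.
exists [set [set S : hull_kernel A | ~ S a]]; last by rewrite bigcup_set1.
move=> _ ->.
have -> : [set S : hull_kernel A | ~ S a]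
    = [set S : hull_kernel A | ~ [set a] `<=` S].
  apply/seteqP; split=> S /= Sa; first by move=> /(_ a erefl).
  by apply: contra_not Sa => Sa _ ->.
exact: finI_from1 (finite_set1 a).
Qed.

(** Avoiding a subset is the union over its elements of the conditions of
    not containing them, so singletons already form a subbase. *)
Lemma continuous_to_hull_kernel (Y : topologicalType) (f : Y -> hull_kernel A) :
  (forall a, open [set y | ~ f y a]) -> continuous f.
Proof.
move=> fo; apply/continuousP => _ [B Bsub <-].
rewrite preimage_bigcup; apply: bigcup_open => U /Bsub[F _ <-].
rewrite preimage_bigcap bigcap_fset.
apply: big_ind => [|V W oV oW|E _]; [exact: openT|exact: openI|].
rewrite (_ : _ @^-1` _ = \bigcup_(a in E) [set y | ~ f y a]).
  by apply: bigcup_open => a _; apply: fo.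
apply/seteqP; split=> y /=.
  by move=> /existsNP[a /not_implyP[Ea fya]]; exists a.
by move=> [a Ea fya] Ef; apply/fya/Ef.
Qed.

End Subbase.

(** * The prime spectrum of the ring of specializing functions *)

Lemma ring_prime_exp (S : comPzRingType) (P : set S) x n :
  ring_prime P -> P (x ^+ n) -> P x.
Proof.
move=> [_ P1 PM]; elim: n => [/P1//|n IH].
by rewrite exprS => /PM[].
Qed.

Section Spectrum.
Variables (A : eqType) (X : set (hull_kernel A)).
Hypothesis XI : setI_closed X.
Hypothesis Xclosed : forall I : set A,
  (forall s, exists2 J, X J & same_trace s J I) -> X I.
Local Notation R := (section_ring X).
Implicit Types (p q : X) (s : seq A) (f g : R).

Lemma ring_prime_radical (P : set R) f g :
  ring_prime P -> (forall q, g q = 0 -> f q = 0) -> P g -> P f.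
Proof.
move=> pP gf0 Pg; have [n [h fhg]] := section_radical gf0.
apply: (ring_prime_exp (n := n.+1) pP); rewrite fhg.
by have [[_ _ PM] _ _] := pP; apply: PM.
Qed.

(** Closure of [X] under intersections enters here: a function determined by
    the trace on [s] takes the same value at [q] and at the intersection of [q]
    with [p], which specializes to [p]. *)
Lemma support_open f : exists s, forall p q,
  (forall a, a \in s -> val q a -> val p a) -> f p != 0 -> f q != 0.
Proof.
have [_ _ [s sf]] := sectionP f; exists s => p q qp fp0.
have Xqp : val q `&` val p \in X.
  by apply/mem_set/XI; apply/set_mem/valP.
pose r : X := exist _ (val q `&` val p) Xqp.
rewrite (sf q r) => [|a sa].
  by apply: specialize_neq0 fp0; apply: subIsetr.
by split=> [qa|[]//]; split=> //; apply: qp.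
Qed.

Lemma open_support f : open [set q | f q != 0].
Proof.
have [s fs] := support_open f.
rewrite (_ : [set q | _] = \bigcup_(p in [set p | f p != 0])
    [set q | forall a, a \in s -> val q a -> val p a]); last first.
  apply/seteqP; split=> q /=; first by exists q.
  by move=> [p fp qp]; apply: fs fp.
apply: bigcup_open => p _.
elim: s {fs} => [|a s IH].
  rewrite (_ : mkset _ = setT); first exact: openT.
  by apply/seteqP; split=> // q _ a; rewrite in_nil.
rewrite (_ : mkset _ = [set q | val q a -> val p a] `&`
    [set q | forall a, a \in s -> val q a -> val p a]); last first.
  apply/seteqP; split=> q /=.
    move=> qp; split; first by apply: qp; rewrite mem_head.
    by move=> b sb; apply: qp; rewrite inE sb orbT.
  by move=> [qpa qp] b; rewrite inE => /orP[/eqP->//|/qp].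
apply: openI => //; have [pa|pa] := pselect (val p a).
  rewrite (_ : mkset _ = setT); first exact: openT.
  by apply/seteqP; split=> // q _.
rewrite (_ : mkset _ = val @^-1` [set S : hull_kernel A | ~ S a]).
  exists [set S : hull_kernel A | ~ S a] => //.
  exact: hull_kernel_open_notin.
by apply/seteqP; split=> q /=; [move=> qpa /qpa|move=> nqa /nqa].
Qed.

(** Squares cannot cancel in the field of values, so a sum of squares of
    elements of [P] is an element of [P] whose zeros are the common zeros of its
    terms. *)
Lemma sum_squares_indicators (P : set R) s : ring_prime P ->
  (forall a, a \in s -> P (indicator X a)) ->
  exists2 r, P r & forall q, r q = 0 -> forall a, a \in s -> val q a.
Proof.
move=> pP; elim: s => [|a s IH] Ps.
  by exists 0 => //; have [[]] := pP.
have [|r Pr rs] := IH; first by move=> b sb; apply: Ps; rewrite inE sb orbT.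
have [[_ PD PM] _ _] := pP.
exists (r ^+ 2 + indicator X a ^+ 2).
  by rewrite !expr2; apply: PD; apply: PM => //; apply: Ps; rewrite mem_head.
move=> q; rewrite sectionD !sectionX => /sum_squares_eq0[rq aq] b.
by rewrite inE => /orP[/eqP->|/(rs q rq)//]; apply/indicator_eq0.
Qed.

(** Witnessed by the product of the indicators. *)
Lemma prod_indicators (P : set R) s : ring_prime P ->
  (forall a, a \in s -> ~ P (indicator X a)) ->
  exists2 r, ~ P r & forall q, r q != 0 -> forall a, a \in s -> ~ val q a.
Proof.
move=> pP; have [_ P1 PM] := pP; elim: s => [|a s IH] Ps.
  by exists 1.
have [|r Pr rs] := IH; first by move=> b sb; apply: Ps; rewrite inE sb orbT.
exists (r * indicator X a).
  by move=> /PM[//|]; apply: Ps; rewrite mem_head.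
move=> q; rewrite sectionM mulf_eq0 negb_or => /andP[rq aq] b.
rewrite inE => /orP[/eqP->|/(rs q rq)//] /indicator_eq0 qa.
by rewrite qa eqxx in aq.
Qed.

Definition point_of_prime (P : set R) : set A := [set a | P (indicator X a)].

(** Otherwise the trace of the point on some [s] is not attained in [X].  Split
    [s] into the elements inside and outside the point, and take a sum of
    squares for the former, in [P], and a product for the latter, outside [P].
    A member of [X] where the sum vanishes and the product does not would have
    the trace of the point; so the product vanishes wherever the sum does, and
    is in [P]. *)
Lemma point_of_primeP (P : set R) : ring_prime P -> X (point_of_prime P).
Proof.
move=> pP; apply: Xclosed => s; apply: contrapT => nX.
pose b a : bool := `[< point_of_prime P a >].
have [|r Pr rs] := @sum_squares_indicators P [seq a <- s | b a] pP.
  by move=> a; rewrite mem_filter => /andP[/asboolP].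
have [|t Pt ts] := @prod_indicators P [seq a <- s | ~~ b a] pP.
  by move=> a; rewrite mem_filter => /andP[/asboolPn].
apply: Pt; apply: (ring_prime_radical pP _ Pr) => q rq.
apply/eqP; apply: contrapT => /negP tq; apply: nX; exists (val q).
  exact/set_mem/valP.
move=> a sa; split; last first.
  by move=> Pa; apply: (rs q rq); rewrite mem_filter sa andbT; apply/asboolP.
apply: contraPP => Pa; apply: (ts q tq); rewrite mem_filter sa andbT.
exact/asboolPn.
Qed.

Lemma prime_of_pointP q : ring_prime [set f : R | f q = 0].
Proof.
split=> [|/= /eqP|f g fg0]; last 2 first.
- by rewrite oner_eq0.
- have /eqP : f q * g q = 0 := fg0.
  by rewrite mulf_eq0 => /orP[]/eqP; [left|right].
split=> [//|f g fq gq|g f fq].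
- by change (f q + g q = 0); rewrite fq gq addr0.
- by change (g q * f q = 0); rewrite fq mulr0.
Qed.

(** Membership of [f] in a prime depends only on the support of [f].  Let [s]
    determine this support.  If [f] does not vanish at [q], its support contains
    that of the product of the indicators of the elements of [s] outside [q],
    which is not in [P].  If [f] vanishes at [q], its support is contained in
    the union of those of the indicators of the elements of [s] in [q], which
    are in [P]. *)
Lemma prime_zero_locus (P : set R) q f :
  ring_prime P -> val q = point_of_prime P -> P f <-> f q = 0.
Proof.
move=> pP qP; have [s fs] := support_open f.
pose b a : bool := `[< val q a >]; split=> [Pf|fq].
  apply/eqP; apply: contrapT => /negP fq0.
  have [|t Pt ts] := @prod_indicators P [seq a <- s | ~~ b a] pP.
    by move=> a; rewrite mem_filter /= /b qP => /andP[/asboolPn].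
  apply: Pt; apply: (ring_prime_radical pP _ Pf) => p fp.
  apply/eqP; apply: contrapT => /negP tp.
  have : f p != 0; last by rewrite fp eqxx.
  apply: fs fq0 => a sa; apply: contraPP => qa.
  by apply: (ts p tp); rewrite mem_filter sa andbT; apply/asboolPn.
have [|r Pr rs] := @sum_squares_indicators P [seq a <- s | b a] pP.
  by move=> a; rewrite mem_filter /b qP => /andP[/asboolP].
apply: (ring_prime_radical pP _ Pr) => p rp.
apply/eqP; apply: contrapT => /negP fp.
have : f q != 0; last by rewrite fq eqxx.
apply: fs fp => a sa qa; apply: (rs p rp); rewrite mem_filter sa andbT.
exact/asboolP.
Qed.

Theorem spectral_of_closed_family : spectral (set_type X).
Proof.
exists R.
pose phi (q : X) : Spec R := exist _ _ (prime_of_pointP q).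
pose psi (P : Spec R) : X :=
  exist (fun I => I \in X) _ (mem_set (point_of_primeP (svalP P))).
exists phi, psi; split.
- move=> q; apply: val_inj; apply/seteqP; split=> a.
    exact: (indicator_eq0 a q).1.
  exact: (indicator_eq0 a q).2.
- move=> [P pP]; apply: eq_exist; apply/seteqP; split=> f.
    exact: (prime_zero_locus (q := psi (exist _ P pP)) f pP erefl).2.
  exact: (prime_zero_locus (q := psi (exist _ P pP)) f pP erefl).1.
- apply/continuousP => _ [E ->].
  rewrite (_ : _ @^-1` _ = \bigcup_(f in E) [set q | f q != 0]).
    by apply: bigcup_open => f _; apply: open_support.
  apply/seteqP; split=> q /=.
    by move=> /existsNP[f /not_implyP[Ef /eqP fq]]; exists f.
  by move=> [f Ef /eqP fq] /(_ f Ef).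
- apply/continuousP => _ [B oB <-].
  have /continuousP : continuous (fun P => val (psi P) : hull_kernel A).
    apply: continuous_to_hull_kernel => a.
    exists [set indicator X a]; apply/seteqP; split=> P /=.
      by move=> Pa /(_ _ erefl).
    by apply: contra_not => Pa _ ->.
  exact.
Qed.

End Spectrum.

(** * Ideals of a commutative monoid with base point *)

Theorem corollary3p4 (A : pointedComMonoidType) :
  spectral (set_type (Id A)) /\ spectral (set_type (Id_proper A)).
Proof.
(* The conditions defining an ideal involve the element [mzero], or a pair [a],
   [a * b]; for an ideal, being proper involves the element [1] alone. *)
have IdI : setI_closed (Id A).
  move=> I J [I0 IM] [J0 JM]; split=> // a b [Ia Ja].
  by split; [apply: IM|apply: JM].
have Idclosed (I : set A) :
    (forall s : seq A, exists2 J, Id A J & same_trace s J I) -> Id A I.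
  move=> IJ; split=> [|a b Ia].
    by have [J [J0 _] JI] := IJ [:: mzero]; apply/JI => //; rewrite mem_head.
  have [J [_ JM] JI] := IJ [:: a; (a * b)%g].
  apply/JI; first by rewrite !inE eqxx orbT.
  by apply/JM/JI => //; rewrite mem_head.
have properP (I : set A) : monoid_ideal I -> I <> [set: A] <-> ~ I 1%g.
  move=> [_ IM]; split; apply: contra_not; last by move=> ->.
  move=> I1; apply/seteqP; split=> // a _.
  by rewrite -(mul1g a); apply: IM.
split; apply: spectral_of_closed_family => //.
- move=> I J [iI nI] [iJ nJ]; split; first exact: IdI.
  move=> IJ; apply: nI; apply/seteqP; split=> // a _.
  by have [] : (I `&` J) a by rewrite IJ.
- move=> I IJ; have iI : Id A I.
    by apply: Idclosed => s; have [J [iJ _] JI] := IJ s; exists J.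
  split=> //; apply/properP => // I1.
  have [J [iJ nJ] JI] := IJ [:: 1%g].
  have nJ1 : ~ J 1%g by apply/properP.
  by apply/nJ1/JI; rewrite ?mem_head.
Qed.
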